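(* Let $K\subset\mathbb{R}^n$ be a Euclidean cubical complex with minimal vertex $\mathbf{0}$, i.e. $\mathbf{0}\in K_0$ and $\mathbf{0}\preceq\mathbf{v}$ for every vertex $\mathbf{v}\in K_0$. Suppose that for every vertex $\mathbf{k}\in K_0$ the past link $lk^-_{K,\mathbf{0}}(\mathbf{k})$ is connected. Then for every $\mathbf{k}\in K_0$ the space of directed paths $\overrightarrow{P}_{\mathbf{0}}^{\mathbf{k}}(K)$ is connected. (Here the empty space counts as connected, both in the hypothesis and in the conclusion.)
   Context: For $\mathbf{p},\mathbf{q}\in\mathbb{R}^n$ write $\mathbf{p}\preceq\mathbf{q}$ if $p_i\le q_i$ for all $i$, and $[\mathbf{p},\mathbf{q}]=\{\mathbf{x}\in\mathbb{R}^n:\mathbf{p}\preceq\mathbf{x}\preceq\mathbf{q}\}$. If $\mathbf{p},\mathbf{q}\in\mathbb{Z}^n$ and $\mathbf{q}-\mathbf{p}\in\{0,1\}^n$, then $[\mathbf{p},\mathbf{q}]$ is an elementary cube. A Euclidean cubical complex $K\subseteq\mathbb{R}^n$ is a union of elementary cubes; its vertex set $K_0$ is the set of integer points (elementary $0$-cubes) contained in $K$. A directed path (dipath) in $K$ is a continuous map $\alpha:[0,1]\to K$ each of whose coordinate functions is non-decreasing. For $\mathbf{x},\mathbf{y}\in K$, $\overrightarrow{P}_{\mathbf{x}}^{\mathbf{y}}(K)$ is the space of dipaths $\alpha$ in $K$ with $\alpha(0)=\mathbf{x}$ and $\alpha(1)=\mathbf{y}$, with the compact-open topology. Let $\Delta^{n-1}$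 be the full simplicial complex on the vertex set $\{1,\dots,n\}$; a simplex $S\subseteq\{1,\dots,n\}$ is identified with its indicator vector $\mathbf{j}\in\{0,1\}^n$ ($\mathbf{j}=\mathbf{0}$ corresponds to the empty simplex). The past link $lk^-_{K,\mathbf{w}}(\mathbf{v})$ of a vertex $\mathbf{v}$ with respect to a vertex $\mathbf{w}$ is the simplicial subcomplex of $\Delta^{n-1}$ given by: $\mathbf{j}\in lk^-_{K,\mathbf{w}}(\mathbf{v})$ if and only if $[\mathbf{v}-\mathbf{j},\mathbf{v}]\subseteq K\cap[\mathbf{w},\mathbf{v}]$. Connectedness of a past link refers to its geometric realization (for instance, $lk^-_{K,\mathbf{0}}(\mathbf{0})$ is empty, hence connected by the convention in the claim). *)

(* Defs.v *)
From HB Require Import structures.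
From mathcomp Require Import all_boot all_order all_algebra.
From mathcomp Require Import all_classical all_reals all_analysis homotopy.

Set Implicit Arguments.
Unset Strict Implicit.
Unset Printing Implicit Defensive.

Import Order.TTheory GRing.Theory Num.Theory.
Import numFieldNormedType.Exports.

Local Open Scope classical_set_scope.
Local Open Scope ring_scope.

(* R^n is 'rV[R]_n over R : realType (MathComp-Analysis); points of Z^n are kept
   as integer vectors and embedded in R^n by [toR]. *)

Definition preceq (T : numDomainType) (n : nat) (p q : 'rV[T]_n) : Prop :=
  forall i, p 0 i <= q 0 i.

Definition box (R : realType) (n : nat) (p q : 'rV[R]_n) : set 'rV[R]_n :=
  [set x | preceq p x /\ preceq x q].

Definition toR (R : realType) (n : nat) (v : 'rV[int]_n) : 'rV[R]_n :=
  map_mx (fun z : int => z%:~R) v.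
Arguments toR R {n} v.

Definition elementary (n : nat) (p q : 'rV[int]_n) : Prop :=
  forall i, q 0 i - p 0 i = 0 \/ q 0 i - p 0 i = 1.

(* The family of cubes is arbitrary, possibly infinite. *)
Definition cubical_complex (R : realType) (n : nat) (K : set 'rV[R]_n) : Prop :=
  exists C : set ('rV[int]_n * 'rV[int]_n),
    (forall pq, C pq -> elementary pq.1 pq.2) /\
    K = \bigcup_(pq in C) box (toR R pq.1) (toR R pq.2).

Definition vertices (R : realType) (n : nat) (K : set 'rV[R]_n) :
    set 'rV[int]_n :=
  [set v | K (toR R v)].

Definition minimal_vertex (R : realType) (n : nat) (K : set 'rV[R]_n)
    (w : 'rV[int]_n) : Prop :=
  vertices K w /\ forall v, vertices K v -> preceq w v.

Definition indicator (n : nat) (S : {set 'I_n}) : 'rV[int]_n :=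
  \row_i (i \in S)%:R.

Definition past_link (R : realType) (n : nat) (K : set 'rV[R]_n)
    (w v : 'rV[int]_n) : set {set 'I_n} :=
  [set j | box (toR R (v - indicator j)) (toR R v)
             `<=` K `&` box (toR R w) (toR R v)].

Lemma past_link_simplicial (R : realType) (n : nat) (K : set 'rV[R]_n)
    (w v : 'rV[int]_n) (s t : {set 'I_n}) :
  past_link K w v s -> t \subset s -> past_link K w v t.
Proof.
move=> sL /fintype.subsetP ts x [lx xu]; apply: sL; split=> // i.
apply: le_trans (lx i); rewrite !mxE ler_int lerD2l lerN2.
by case: (boolP (i \in t)) => [/ts ->|] //; case: (i \in s).
Qed.

(* Barycentric coordinates: one coordinate per vertex of the full simplex.
   The empty simplex contributes no point, as the coordinates sum to 1, so
   the complex {set0} has an empty realization, which is [connected]. *)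
Definition realization (R : realType) (n : nat) (L : set {set 'I_n}) :
    set 'rV[R]_n :=
  [set t | [/\ forall i, 0 <= t 0 i, \sum_i t 0 i = 1 &
               L [set i | t 0 i != 0]%SET]].
Arguments realization R {n} L.

(* [0, 1] as a topological space of its own, with its two endpoints marked so
   that the type [{path _ from _ to _ in _}] of continuous paths, which carries
   the compact-open topology, applies to it. *)
Definition unit_itv (R : realType) : Type := set_type (`[0, 1]%classic : set R).

HB.instance Definition _ (R : realType) := 
  Topological.copy (unit_itv R) (set_type (`[0, 1]%classic : set R)).

Section unit_itv_endpoints.
Variable R : realType.

Lemma unit_itv0_subproof : (0 : R) \in (`[0, 1]%classic : set R).
Proof. by rewrite inE /= in_itv /= lexx ler01. Qed.

Lemma unit_itv1_subproof : (1 : R) \in (`[0, 1]%classic : set R).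
Proof. by rewrite inE /= in_itv /= lexx ler01. Qed.

Definition unit_itv0 : unit_itv R := exist _ 0 unit_itv0_subproof.
Definition unit_itv1 : unit_itv R := exist _ 1 unit_itv1_subproof.

Lemma unit_itv_neq : unit_itv0 != unit_itv1.
Proof. by apply/eqP => -[] /eqP; rewrite eq_sym oner_eq0. Qed.

HB.instance Definition _ := isBiPointed.Build (unit_itv R) unit_itv_neq.

End unit_itv_endpoints.

Definition dipaths (R : realType) (n : nat) (K : set 'rV[R]_n)
    (x y : set_type K) : set {path (unit_itv R) from x to y in set_type K} :=
  [set a : {path (unit_itv R) from x to y in set_type K} | forall s t : unit_itv R,
     set_val s <= set_val t -> preceq (set_val (a s)) (set_val (a t))].
Arguments dipaths {R n} K x y.

Definition vertex_point (R : realType) (n : nat) (K : set 'rV[R]_n)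
    (v : 'rV[int]_n) (Kv : vertices K v) : set_type K :=
  exist _ (toR R v) (mem_set Kv).

(* Main.v *)
Require Import Defs.
From HB Require Import structures.
From mathcomp Require Import all_boot all_order all_algebra.
From mathcomp Require Import all_classical all_reals all_analysis homotopy.
From mathcomp Require Import lra zify ring.
From Stdlib Require Import Relation_Operators.

Set Implicit Arguments.
Unset Strict Implicit.
Unset Printing Implicit Defensive.

Import Order.TTheory GRing.Theory Num.Theory.
Import numFieldNormedType.Exports.
Local Open Scope classical_set_scope.
Local Open Scope ring_scope.

(* Induct on the height of k.  Near its end a dipath f to k lies in a cube
   [k - j, k] of K; a coordinatewise monotone self-map of R fixing the integers
   preserves every cube, so moving f linearly along such maps makes it pass
   through some k - e_i.  By induction the class of f then depends only on i.
   If {a, b} is an edge of the past link of k, the dipaths through k - e_a and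
   k - e_b can be exchanged across the square [k - e_a - e_b, k], provided its
   bottom vertex is reachable from 0; connectedness of the link then joins all
   classes.  Reachability also comes from connected links: if w is reachable
   and some lower neighbour of w is not, an edge of the link of w joins a
   reachable w - e_b to an unreachable w - e_a, and then w - e_a - e_b is an
   unreachable lower neighbour of w - e_b; this descent cannot go on forever. *)

(** * Continuity into R^n, the clamp onto [0, 1], and dipaths as curves on the line *)

Lemma rV_continuous (R : realType) (T : topologicalType) n (f : T -> 'rV[R]_n) :
  (forall j, continuous (fun t => f t 0 j)) -> continuous f.
Proof.
move=> cf t A [P Pt PA].
rewrite nbhs_filterE.
have : \forall u \near t, forall j, P 0 j (f u 0 j).
  by apply: filter_forall => j; exact: (cf j t (P 0 j) (Pt 0 j)).
by apply: filterS => u Pu; apply: PA => i j; rewrite ord1; exact: Pu.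
Qed.

Definition clamp01 (R : realType) (t : R) : R := Num.max 0 (Num.min 1 t).

Section clamp01.
Variable R : realType.
Implicit Types s t : R.

Lemma clamp01_continuous : continuous (@clamp01 R).
Proof.
move=> t; apply: continuous_max; first exact: cvg_cst.
by apply: continuous_min; [exact: cvg_cst | exact: cvg_id].
Qed.

Lemma clamp01_ge0 t : 0 <= clamp01 t.
Proof. by rewrite /clamp01 le_max lexx. Qed.

Lemma clamp01_le1 t : clamp01 t <= 1.
Proof. by rewrite /clamp01 ge_max ler01 ge_min lexx. Qed.

Lemma clamp01_id t : 0 <= t <= 1 -> clamp01 t = t.
Proof. by case/andP=> t0 t1; rewrite /clamp01 (min_idPr t1) (max_idPr t0). Qed.

Lemma clamp01_le0 t : t <= 0 -> clamp01 t = 0.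
Proof.
by move=> t0; rewrite /clamp01 (min_idPr (le_trans t0 ler01)) (max_idPl t0).
Qed.

Lemma clamp01_ge1 t : 1 <= t -> clamp01 t = 1.
Proof. by move=> t1; rewrite /clamp01 (min_idPl t1) (max_idPr ler01). Qed.

Lemma clamp01_homo s t : s <= t -> clamp01 s <= clamp01 t.
Proof.
by move=> st; rewrite /clamp01 ge_max !le_max lexx /= le_min !ge_min lexx st !orbT.
Qed.

End clamp01.

(* Dipaths are handled as maps defined on the whole line, constant outside
   [0, 1]; truncations and gluings then need no change of domain. *)
Record dicurve (R : realType) n (K : set 'rV[R]_n) (k : 'rV[int]_n)
    (f : R -> 'rV[R]_n) : Prop := Dicurve {
  dicurve_cts : continuous f;
  dicurve_homo : forall s t, s <= t -> preceq (f s) (f t);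
  dicurve_in : forall t, K (f t);
  dicurve_le0 : forall t, t <= 0 -> f t = 0;
  dicurve_ge1 : forall t, 1 <= t -> f t = toR R k }.

(** Joint continuity is what currying turns into a path of dipaths. Outside 0 <= [s] <= 1 the map
    [H s] need not be a dipath. *)
Definition dihomotopic (R : realType) n (K : set 'rV[R]_n) k
    (f g : R -> 'rV[R]_n) : Prop :=
  exists H : R -> R -> 'rV[R]_n,
    [/\ continuous (fun st : R * R => H st.1 st.2),
        forall s, 0 <= s <= 1 -> dicurve K k (H s), H 0 = f & H 1 = g].

(** Taking the closure avoids concatenating homotopies; lying in one connected component is an
    equivalence relation anyway. *)
Definition diequiv (R : realType) n (K : set 'rV[R]_n) k :=
  clos_refl_sym_trans _ (dihomotopic K k).

Lemma dihomotopic_dicurve (R : realType) n (K : set 'rV[R]_n) k f g :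
  dihomotopic K k f g -> dicurve K k f /\ dicurve K k g.
Proof.
by case=> H [_ HK <- <-]; split; apply: HK; rewrite ?lexx ?ler01.
Qed.

(** Reflexivity relates also maps that are no dipaths, whence an equivalence here and not a
    conjunction. *)
Lemma diequiv_dicurve (R : realType) n (K : set 'rV[R]_n) k f g :
  diequiv K k f g -> dicurve K k f <-> dicurve K k g.
Proof.
elim=> {f g} [f g /dihomotopic_dicurve[]//|//|f g _ [? ?]|f g h _ [? ?] _ [? ?]].
  by split.
by split; auto.
Qed.

(** * From dihomotopies to connectedness of the dipath space *)

Section path_of_dicurve.
Variables (R : realType) (n : nat) (K : set 'rV[R]_n) (k : 'rV[int]_n).
Variables (K0 : vertices K 0) (Kk : vertices K k).

Local Notation pathK :=
  {path (unit_itv R) from (vertex_point K0) to (vertex_point Kk) in set_type K}.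

Definition restr_dicurve (f : R -> 'rV[R]_n) (df : dicurve K k f)
    (t : unit_itv R) : set_type K :=
  exist _ (f (set_val t)) (mem_set (dicurve_in df (set_val t))).

Lemma restr_dicurve_cts f (df : dicurve K k f) : continuous (restr_dicurve df).
Proof.
apply: continuous_comp_initial => t.
rewrite (_ : _ \o _ = f \o set_val) //.
by apply: continuous_comp; [exact: initial_continuous | exact: dicurve_cts df _].
Qed.

Lemma restr_dicurve_zero f (df : dicurve K k f) :
  restr_dicurve df zero = vertex_point K0.
Proof.
apply: val_inj => /=; rewrite (dicurve_le0 df) ?set_valE //=.
by apply/rowP => i; rewrite !mxE.
Qed.

Lemma restr_dicurve_one f (df : dicurve K k f) :
  restr_dicurve df one = vertex_point Kk.
Proof. by apply: val_inj => /=; rewrite (dicurve_ge1 df) ?set_valE //=. Qed.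

Definition path_of f (df : dicurve K k f) : pathK :=
  mk_path (@restr_dicurve_cts f df) (restr_dicurve_zero df) (restr_dicurve_one df).

Lemma path_of_dipath f (df : dicurve K k f) :
  dipaths K (vertex_point K0) (vertex_point Kk) (path_of df).
Proof. by move=> s t st; exact: (dicurve_homo df). Qed.

Lemma path_of_irr f (df df' : dicurve K k f) : path_of df = path_of df'.
Proof. by rewrite (Prop_irrelevance df df'). Qed.

Lemma clamp01_in_itv (t : R) : clamp01 t \in (`[0, 1]%classic : set R).
Proof. by rewrite inE /= in_itv /= clamp01_ge0 clamp01_le1. Qed.

Definition clamp_itv (t : R) : unit_itv R := exist _ (clamp01 t) (clamp01_in_itv t).

Lemma clamp_itv_cts : continuous clamp_itv.
Proof.
apply: continuous_comp_initial => t.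
by rewrite (_ : _ \o _ = @clamp01 R) //; exact: clamp01_continuous.
Qed.

(** Precomposition with the clamp of the line onto [0, 1] extends a dipath by constants on both
    sides. *)
Lemma dipath_dicurve (a : pathK) :
  dipaths K (vertex_point K0) (vertex_point Kk) a ->
  exists (f : R -> 'rV[R]_n) (df : dicurve K k f), a = path_of df.
Proof.
move=> da; pose f t := set_val (a (clamp_itv t)).
have df : dicurve K k f.
  split.
  - move=> t; rewrite (_ : f = set_val \o (a \o clamp_itv)) //.
    apply: continuous_comp; last exact: initial_continuous.
    by apply: continuous_comp; [exact: clamp_itv_cts | exact: cts_fun].
  - by move=> s t st; apply: da; rewrite !set_valE /=; exact: clamp01_homo.
  - by move=> t; exact: set_valP.
  - move=> t t0; rewrite /f (_ : clamp_itv t = zero) ?path_zero.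
      by rewrite set_valE /=; apply/rowP => i; rewrite !mxE.
    by apply: val_inj => /=; exact: clamp01_le0.
  - move=> t t1; rewrite /f (_ : clamp_itv t = one) ?path_one //.
    by apply: val_inj => /=; exact: clamp01_ge1.
exists f, df; apply/path_eqP => t; apply: val_inj => /=.
rewrite /f; congr (set_val (a _)); apply: val_inj => /=.
by rewrite clamp01_id //; have := set_valP t; rewrite set_valE /= in_itv.
Qed.

(** The space of paths has the topology induced by the compact-open one, so currying the homotopy
    gives a continuous map into it; the image of [0, 1] is a connected set of dipaths containing
    both ends. *)
Lemma dihomotopic_component f g (df : dicurve K k f) (dg : dicurve K k g) :
  dihomotopic K k f g ->
  connected_component (dipaths K (vertex_point K0) (vertex_point Kk))
    (path_of df) (path_of dg).
Proof.
case=> H [Hc HK H0 H1].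
(* Clamping [s] yields a family of dipaths indexed by the whole line. *)
have cH s : dicurve K k (H (clamp01 s)).
  by apply: HK; rewrite clamp01_ge0 clamp01_le1.
pose F (st : R * unit_itv R) : set_type K := restr_dicurve (cH st.1) st.2.
have Fc : continuous F.
  apply: continuous_comp_initial => st.
  rewrite (_ : _ \o _ = (fun st : R * R => H st.1 st.2) \o
      (fun st : R * unit_itv R => (clamp01 st.1, set_val st.2))) //.
  apply: continuous_comp; last exact: Hc.
  apply: (@cvg_pair _ _ _ (nbhs st) (nbhs (clamp01 st.1)) (nbhs (set_val st.2))).
    apply: (@continuous_comp _ _ _ fst (@clamp01 R)); first exact: cvg_fst.
    exact: clamp01_continuous.
  apply: (@continuous_comp _ _ _ snd set_val); first exact: cvg_snd.
  exact: initial_continuous.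
pose G s := path_of (cH s).
have Gc : continuous G.
  apply: continuous_comp_initial.
  exact: (continuous_curry_fun Fc).
have seg : connected (G @` `[0, 1]%classic).
  apply: connected_continuous_connected; first exact: segment_connected.
  exact: continuous_subspaceT.
have path_ofE u v (du : dicurve K k u) (dv : dicurve K k v) :
    u = v -> path_of du = path_of dv.
  by move=> uv; case: _ / uv dv => dv; exact: path_of_irr.
exists (G @` `[0, 1]%classic).
  split=> //.
    exists 0; first by rewrite /= in_itv /= lexx ler01.
    by apply: path_ofE; rewrite clamp01_le0.
  by move=> _ [s _ <-]; exact: path_of_dipath.
exists 1; first by rewrite /= in_itv /= lexx ler01.
by apply: path_ofE; rewrite clamp01_ge1.
Qed.

Lemma diequiv_component f g (df : dicurve K k f) (dg : dicurve K k g) :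
  diequiv K k f g ->
  connected_component (dipaths K (vertex_point K0) (vertex_point Kk))
    (path_of df) (path_of dg).
Proof.
move=> fg; elim: fg df dg => {f g}.
- by move=> f g fg df dg; exact: dihomotopic_component.
- move=> f df dg; rewrite (path_of_irr df dg).
  by apply: connected_component_refl; exact: path_of_dipath.
- by move=> f g _ IH df dg; apply: connected_component_sym; exact: IH.
- move=> f g h fg IHfg _ IHgh df dh.
  have dg : dicurve K k g by apply/(diequiv_dicurve fg).
  by apply: connected_component_trans (IHfg df dg) (IHgh dg dh).
Qed.

(** Either there is no dipath, and the empty set is connected, or the dipaths form the component of
    any one of them. *)
Lemma diequiv_connected :
  (forall f g, dicurve K k f -> dicurve K k g -> diequiv K k f g) ->
  connected (dipaths K (vertex_point K0) (vertex_point Kk)).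
Proof.
move=> eqv; set P := dipaths _ _ _.
have [[a Pa]|P0] := pselect (exists a, P a); last first.
  suff -> : P = set0 by exact: connected0.
  by rewrite predeqE => a; split=> // Pa; case: P0; exists a.
rewrite (_ : P = connected_component P a); first exact: component_connected.
apply/seteqP; split=> [b Pb|]; last exact: connected_component_sub.
have [f [df ->]] := dipath_dicurve Pa; have [g [dg ->]] := dipath_dicurve Pb.
by apply: diequiv_component; exact: eqv.
Qed.

End path_of_dicurve.

(** * Continuity of pointwise operations *)

Section pointwise_continuity.
Variables (R : realType) (T : topologicalType).
Implicit Types f g : T -> R.

Lemma cts_cst (c : R) : continuous (fun _ : T => c).
Proof. by move=> t; exact: cvg_cst. Qed.

Lemma ctsD f g : continuous f -> continuous g -> continuous (fun t => f t + g t).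
Proof. by move=> cf cg t; apply: cvgD; [exact: cf|exact: cg]. Qed.

Lemma ctsB f g : continuous f -> continuous g -> continuous (fun t => f t - g t).
Proof. by move=> cf cg t; apply: cvgB; [exact: cf|exact: cg]. Qed.

Lemma ctsM f g : continuous f -> continuous g -> continuous (fun t => f t * g t).
Proof. by move=> cf cg t; apply: cvgM; [exact: cf|exact: cg]. Qed.

Lemma cts_max f g : continuous f -> continuous g ->
  continuous (fun t => Num.max (f t) (g t)).
Proof. by move=> cf cg t; apply: continuous_max; [exact: cf|exact: cg]. Qed.

Lemma cts_min f g : continuous f -> continuous g ->
  continuous (fun t => Num.min (f t) (g t)).
Proof. by move=> cf cg t; apply: continuous_min; [exact: cf|exact: cg]. Qed.

End pointwise_continuity.

Lemma cts_id (R : realType) : continuous (fun t : R => t).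
Proof. by move=> t; exact: cvg_id. Qed.

Lemma cts_comp (T U V : topologicalType) (f : T -> U) (g : U -> V) :
  continuous f -> continuous g -> continuous (fun t => g (f t)).
Proof. by move=> cf cg t; apply: continuous_comp; [exact: cf|exact: cg]. Qed.

Lemma cts_pair (T U V : topologicalType) (f : T -> U) (g : T -> V) :
  continuous f -> continuous g -> continuous (fun t => (f t, g t)).
Proof. by move=> cf cg t; apply: cvg_pair; [exact: cf|exact: cg]. Qed.

(** * Dihomotopies, and dipaths through a lower neighbour of the endpoint *)

Section homotopies.
Variables (R : realType) (n : nat) (K : set 'rV[R]_n).
Implicit Types (k v : 'rV[int]_n) (f g : R -> 'rV[R]_n) (i : 'I_n).

Lemma shiftE (v : 'rV[R]_n) c i j : (v + c *: 'e_i) 0 j = v 0 j + c * (j == i)%:R.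
Proof. by rewrite !mxE eqxx. Qed.

Lemma toR_subE k i j :
  toR R (k - indicator [set i]%SET) 0 j = toR R k 0 j - (j == i)%:R.
Proof. by rewrite !mxE inE intrB; case: eqP. Qed.

Lemma continuous_coord (T : topologicalType) (f : T -> 'rV[R]_n) j :
  continuous f -> continuous (fun t => f t 0 j).
Proof.
move=> cf t; apply: (@continuous_comp _ _ _ f (fun v : 'rV[R]_n => v 0 j)).
  exact: cf.
exact: coord_continuous.
Qed.

Lemma continuous_fst_R : continuous (fun st : R * R => st.1).
Proof. by move=> st; exact: cvg_fst. Qed.

Lemma continuous_snd_comp (T : topologicalType) (f : R -> T) :
  continuous f -> continuous (fun st : R * R => f st.2).
Proof.
move=> cf st; apply: (@continuous_comp _ _ _ snd f); [exact: cvg_snd|exact: cf].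
Qed.

Lemma continuous_snd_R : continuous (fun st : R * R => st.2).
Proof. by move=> st; exact: cvg_snd. Qed.

(** Boxes are convex, and convex combinations of monotone curves are monotone. The corners are real
    vectors, so that one-point boxes are allowed too. *)
Lemma dihomotopic_line k f g :
  dicurve K k f -> dicurve K k g ->
  (forall t, exists p q, [/\ box p q `<=` K, box p q (f t) & box p q (g t)]) ->
  dihomotopic K k f g.
Proof.
move=> df dg box_fg; exists (fun s t => f t + s *: (g t - f t)); split.
- apply: rV_continuous => j.
  rewrite (_ : (fun _ => _) = fun st : R * R =>
      f st.2 0 j + st.1 * (g st.2 0 j - f st.2 0 j)); last first.
    by apply/funext => st; rewrite !mxE.
  have cf := continuous_snd_comp (continuous_coord (j := j) (dicurve_cts df)).
  have cg := continuous_snd_comp (continuous_coord (j := j) (dicurve_cts dg)).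
  apply: ctsD; first exact: cf.
  by apply: ctsM; [exact: continuous_fst_R | apply: ctsB; [exact: cg|exact: cf]].
- move=> s /andP[s0 s1]; split.
  + apply: rV_continuous => j.
    rewrite (_ : (fun _ => _) = fun t => f t 0 j + s * (g t 0 j - f t 0 j)); last first.
      by apply/funext => st; rewrite !mxE.
    have cf := continuous_coord (dicurve_cts df) (j := j).
    have cg := continuous_coord (dicurve_cts dg) (j := j).
    apply: ctsD; first exact: cf.
    apply: ctsM; first exact: cts_cst.
    by apply: ctsB; [exact: cg|exact: cf].
  + move=> t u tu i; have := dicurve_homo df tu i; have := dicurve_homo dg tu i.
    by rewrite !mxE; nra.
  + move=> t; have [p [q [pqK [pf fq] [pg gq]]]] := box_fg t.
    apply: pqK; split=> i; move: (pf i) (fq i) (pg i) (gq i); rewrite !mxE; nra.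
  + by move=> t t0; rewrite (dicurve_le0 df t0) (dicurve_le0 dg t0) subrr scaler0 addr0.
  + by move=> t t1; rewrite (dicurve_ge1 df t1) (dicurve_ge1 dg t1) subrr scaler0 addr0.
- by apply/funext => t; rewrite scale0r addr0.
- by apply/funext => t; rewrite scale1r addrC subrK.
Qed.

(* A dipath to k through k - e_i splits as g + m e_i, where g runs from 0 to
   k - e_i and the ramp m vanishes until g has arrived. *)
Record ramp (m : R -> R) : Prop := Ramp {
  ramp_cts : continuous m;
  ramp_homo : forall s t, s <= t -> m s <= m t;
  ramp_le0 : forall t, t <= 0 -> m t = 0;
  ramp_ge1 : forall t, 1 <= t -> m t = 1 }.

Lemma ramp_itv m : ramp m -> forall t, 0 <= m t <= 1.
Proof.
move=> rm t; apply/andP; split.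
  have [t0|/ltW t0] := leP t 0; first by rewrite (ramp_le0 rm).
  by rewrite -(ramp_le0 rm (lexx 0)) (ramp_homo rm).
have [t1|/ltW t1] := leP 1 t; first by rewrite (ramp_ge1 rm).
by rewrite -(ramp_ge1 rm (lexx 1)) (ramp_homo rm).
Qed.

Lemma ramp_convex m1 m2 s : 0 <= s <= 1 -> ramp m1 -> ramp m2 ->
  ramp (fun t => m1 t + s * (m2 t - m1 t)).
Proof.
move=> /andP[s0 s1] r1 r2; split.
- apply: ctsD; first exact: ramp_cts r1.
  apply: ctsM; first exact: cts_cst.
  by apply: ctsB; [exact: ramp_cts r2|exact: ramp_cts r1].
- move=> t u tu; have := ramp_homo r1 tu; have := ramp_homo r2 tu; nra.
- by move=> t t0; rewrite (ramp_le0 r1 t0) (ramp_le0 r2 t0); ring.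
- by move=> t t1; rewrite (ramp_ge1 r1 t1) (ramp_ge1 r2 t1); ring.
Qed.

(** While [m] is 0 the curve agrees with [g]; afterwards [g] rests at k - e_i and the curve climbs
    the edge to k. *)
Lemma dicurve_ramp k i (g : R -> 'rV[R]_n) (m : R -> R) :
  box (toR R (k - indicator [set i]%SET)) (toR R k) `<=` K ->
  dicurve K (k - indicator [set i]%SET) g -> ramp m ->
  (forall t, m t != 0 -> g t = toR R (k - indicator [set i]%SET)) ->
  dicurve K k (fun t => g t + m t *: 'e_i).
Proof.
move=> iK dg rm mg; split.
- apply: rV_continuous => j.
  rewrite (_ : (fun _ => _) = fun t => g t 0 j + m t * (j == i)%:R); last first.
    by apply/funext => t; rewrite shiftE.
  apply: ctsD; first exact: continuous_coord (dicurve_cts dg).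
  by apply: ctsM; [exact: ramp_cts rm|exact: cts_cst].
- move=> s t st j; have := dicurve_homo dg st j; have := ramp_homo rm st.
  by rewrite !shiftE => ms gs; apply: lerD => //; apply: ler_wpM2r.
- move=> t; have [mt0|mt0] := eqVneq (m t) 0.
    by rewrite mt0 scale0r addr0; exact: dicurve_in dg _.
  apply: iK; rewrite (mg _ mt0); have /andP[m0 m1] := ramp_itv rm t.
  by split=> j; rewrite shiftE toR_subE; case: (j == i) => /=; lra.
- by move=> t t0; rewrite (ramp_le0 rm t0) (dicurve_le0 dg t0) scale0r addr0.
- move=> t t1; rewrite (ramp_ge1 rm t1) (dicurve_ge1 dg t1).
  by apply/rowP => j; rewrite shiftE toR_subE mul1r subrK.
Qed.

(** Normal form of a dipath through k - e_i: [g] at double speed until time 1/2, then the edge in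
    direction [i]. *)
Definition extend i g (t : R) := g (2 * t) + clamp01 (2 * t - 1) *: 'e_i.

Lemma ramp_clamp : ramp (fun t : R => clamp01 (2 * t - 1)).
Proof.
split.
- apply: (@cts_comp _ _ _ (fun t : R => 2 * t - 1) (@clamp01 R)).
    apply: ctsB; last exact: cts_cst.
    by apply: ctsM; [exact: cts_cst|exact: cts_id].
  exact: clamp01_continuous.
- by move=> s t st; apply: clamp01_homo; lra.
- by move=> t t0; apply: clamp01_le0; lra.
- by move=> t t1; apply: clamp01_ge1; lra.
Qed.

(** As c >= 1, the end is reached by time 1, and [g] waits there. *)
Lemma dicurve_scale v g c : 1 <= c -> dicurve K v g ->
  dicurve K v (fun t => g (c * t)).
Proof.
move=> c1 dg; split.
- apply: (@cts_comp _ _ _ (fun t : R => c * t) g).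
    by apply: ctsM; [exact: cts_cst|exact: cts_id].
  exact: dicurve_cts dg.
- by move=> s t st; apply: (dicurve_homo dg); nra.
- by move=> t; exact: dicurve_in dg _.
- by move=> t t0; apply: (dicurve_le0 dg); nra.
- by move=> t t1; apply: (dicurve_ge1 dg); nra.
Qed.

Lemma clamp_neq0 t : clamp01 (2 * t - 1) != 0 :> R -> 1 <= 2 * t.
Proof.
apply: contraR; rewrite -ltNge => t1; apply/eqP/clamp01_le0; lra.
Qed.

Lemma dicurve_extend k i g :
  box (toR R (k - indicator [set i]%SET)) (toR R k) `<=` K ->
  dicurve K (k - indicator [set i]%SET) g -> dicurve K k (extend i g).
Proof.
move=> iK dg; apply: dicurve_ramp => //.
- by apply: dicurve_scale dg; lra.
- exact: ramp_clamp.
- by move=> t /clamp_neq0 t1; exact: dicurve_ge1 dg _ t1.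
Qed.

Lemma dihomotopic_extend k i f g :
  box (toR R (k - indicator [set i]%SET)) (toR R k) `<=` K ->
  dihomotopic K (k - indicator [set i]%SET) f g ->
  dihomotopic K k (extend i f) (extend i g).
Proof.
move=> iK [H [cH dH <- <-]]; exists (fun s => extend i (H s)); split=> //.
- apply: rV_continuous => j.
  rewrite (_ : (fun _ => _) = fun st : R * R => H st.1 (2 * st.2) 0 j
      + clamp01 (2 * st.2 - 1) * (j == i)%:R); last first.
    by apply/funext => t; rewrite shiftE.
  apply: ctsD.
    apply: (@cts_comp _ _ _ (fun st : R * R => (st.1, 2 * st.2))
      (fun st : R * R => H st.1 st.2 0 j)); last exact: continuous_coord cH.
    apply: cts_pair; first exact: continuous_fst_R.
    by apply: ctsM; [exact: cts_cst|exact: continuous_snd_R].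
  apply: ctsM; last exact: cts_cst.
  exact: (continuous_snd_comp (ramp_cts ramp_clamp)).
- by move=> s s01; apply: dicurve_extend => //; exact: dH.
Qed.

Lemma diequiv_extend k i f g :
  box (toR R (k - indicator [set i]%SET)) (toR R k) `<=` K ->
  diequiv K (k - indicator [set i]%SET) f g ->
  diequiv K k (extend i f) (extend i g).
Proof.
move=> iK; elim=> {f g}.
- by move=> f g fg; apply: rst_step; exact: dihomotopic_extend.
- by move=> f; exact: rst_refl.
- by move=> f g _; exact: rst_sym.
- by move=> f g h _ fg _; apply: rst_trans.
Qed.

(** At time [t0] every coordinate but [i] has its final value, so by monotonicity [f] then moves
    along e_i only. This splits [f] into a curve [g] stopped at [t0] and a ramp [m], which are then
    reparametrized into the form of [extend]. *)
Lemma diequiv_via_vertex k i f t0 :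
  box (toR R (k - indicator [set i]%SET)) (toR R k) `<=` K ->
  dicurve K k f -> t0 <= 1 -> f t0 = toR R (k - indicator [set i]%SET) ->
  exists2 g, dicurve K (k - indicator [set i]%SET) g &
    diequiv K k f (extend i g).
Proof.
move=> iK df t01 ft0.
pose g t := f (Num.min t t0).
pose m t := f (Num.max t t0) 0 i - f t0 0 i.
have dg : dicurve K (k - indicator [set i]%SET) g.
  split.
  - apply: (@cts_comp _ _ _ (fun t : R => Num.min t t0) f).
      by apply: cts_min; [exact: cts_id|exact: cts_cst].
    exact: dicurve_cts df.
  - move=> s t st; apply: (dicurve_homo df).
    by rewrite le_min !ge_min st lexx orbT.
  - by move=> t; exact: dicurve_in df _.
  - by move=> t t_le0; apply: (dicurve_le0 df); rewrite ge_min t_le0.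
  - by move=> t t_ge1; rewrite /g (min_idPr (le_trans t01 t_ge1)).
have rm : ramp m.
  split.
  - apply: ctsB; last exact: cts_cst.
    apply: (@cts_comp _ _ _ (fun t : R => Num.max t t0) (fun t => f t 0 i)).
      by apply: cts_max; [exact: cts_id|exact: cts_cst].
    exact: continuous_coord (dicurve_cts df).
  - move=> s t st; rewrite lerB // (dicurve_homo df) //.
    by rewrite ge_max !le_max st lexx orbT.
  - move=> t t_le0; rewrite /m; have [|/ltW tt0] := leP t t0; first by rewrite subrr.
    by rewrite !(dicurve_le0 df) ?subrr // (le_trans tt0).
  - move=> t t_ge1; rewrite /m (max_idPl (le_trans t01 t_ge1)).
    by rewrite (dicurve_ge1 df t_ge1) ft0 toR_subE eqxx opprB addrC subrK.
(* As [t0] may be negative, 0 <= [t] is recorded separately: it gives (1 + s) * t >= t >= t0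
   below. *)
have m0 t : m t != 0 -> t0 <= t /\ 0 <= t.
  move=> mt; split; rewrite leNgt; apply: contra mt => /ltW tt.
    by rewrite /m (max_idPr tt) subrr.
  by rewrite (ramp_le0 rm).
have gE t : t0 <= t -> g t = toR R (k - indicator [set i]%SET).
  by move=> tt; rewrite /g (min_idPr tt).
have fE : f = fun t => g t + m t *: 'e_i.
  apply/funext => t; apply/rowP => j; rewrite shiftE /g /m.
  have [tt|/ltW tt] := leP t t0; first by rewrite subrr mul0r addr0.
  have [->|ji] := eqVneq j i; first by rewrite mulr1 addrC subrK.
  rewrite mulr0 addr0; apply/eqP; rewrite eq_le (dicurve_homo df tt) andbT.
  (* The time [Num.max t 1] is past both [t] and 1, so there coordinate [j] has its final value,
     equal to that at [t0] because j != i. *)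
  have : f t 0 j <= f (Num.max t 1) 0 j by rewrite (dicurve_homo df) // le_max lexx.
  rewrite (@dicurve_ge1 _ _ _ _ _ df (Num.max t 1)) ?le_max ?lexx ?orbT //.
  by rewrite ft0 toR_subE (negbTE ji) subr0.
exists g => //.
(* Running g faster first makes room for sliding the ramp m onto the one used
   by extend: at no time does the ramp start before g has arrived. *)
apply: (@rst_trans _ _ _ (fun t => g (2 * t) + m t *: 'e_i)); apply: rst_step.
  exists (fun s t => g ((1 + s) * t) + m t *: 'e_i); split.
  - apply: rV_continuous => j.
    rewrite (_ : (fun _ => _) = fun st : R * R => g ((1 + st.1) * st.2) 0 j
        + m st.2 * (j == i)%:R); last first.
      by apply/funext => t; rewrite shiftE.
    apply: ctsD.
      apply: (@cts_comp _ _ _ (fun st : R * R => (1 + st.1) * st.2)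
        (fun t => g t 0 j)); last exact: continuous_coord (dicurve_cts dg).
      apply: ctsM; last exact: continuous_snd_R.
      by apply: ctsD; [exact: cts_cst|exact: continuous_fst_R].
    apply: ctsM; last exact: cts_cst.
    exact: (continuous_snd_comp (ramp_cts rm)).
  - move=> s /andP[s0 s1]; apply: dicurve_ramp => //.
      by apply: dicurve_scale => //; lra.
    by move=> t /m0[tt0 t_ge0]; apply: gE; nra.
  - by rewrite [RHS]fE; apply/funext => t; rewrite addr0 mul1r.
  - by apply/funext => t; rewrite -natr1 (addrC 1).
exists (fun s t => g (2 * t) + (m t + s * (clamp01 (2 * t - 1) - m t)) *: 'e_i).
split.
- apply: rV_continuous => j.
  rewrite (_ : (fun _ => _) = fun st : R * R => g (2 * st.2) 0 j
      + (m st.2 + st.1 * (clamp01 (2 * st.2 - 1) - m st.2)) * (j == i)%:R); last first.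
    by apply/funext => t; rewrite shiftE.
  have cm := continuous_snd_comp (ramp_cts rm).
  apply: ctsD.
    apply: (continuous_snd_comp (f := fun t => g (2 * t) 0 j)).
    apply: continuous_coord; apply: (@dicurve_cts _ _ K _ _ (dicurve_scale _ dg)); lra.
  apply: ctsM; last exact: cts_cst.
  apply: ctsD; first exact: cm.
  apply: ctsM; first exact: continuous_fst_R.
  apply: ctsB; last exact: cm.
  exact: (continuous_snd_comp (ramp_cts ramp_clamp)).
- move=> s s01; apply: dicurve_ramp => //.
  + by apply: dicurve_scale => //; lra.
  + exact: ramp_convex s01 rm ramp_clamp.
  move=> t mt; have [/m0[tt0 t_ge0]|/negPn/eqP m_t] := boolP (m t != 0).
    by apply: gE; lra.
  (* Here the ramp of [extend] must be nonzero, and it starts only at 2 * t = 1 >= t0. *)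
  apply: gE; move: mt; rewrite m_t add0r subr0 => mt.
  have /clamp_neq0 : clamp01 (2 * t - 1) != 0 :> R.
    by apply: contraNneq mt => ->; rewrite mulr0.
  by move: t01; lra.
- by apply/funext => t; rewrite mul0r addr0.
- by apply/funext => t; rewrite mul1r (addrC (m t)) subrK.
Qed.

End homotopies.

(** * Monotone maps of the line that fix the integers *)

Definition cube_map (R : realType) (phi : R -> R) : Prop :=
  [/\ continuous phi, {homo phi : x y / x <= y} & forall z : int, phi z%:~R = z%:~R].

Section cube_map.
Variable R : realType.
Implicit Types (m : int) (a : R).

(** The map climbs from m - 1 with slope [c], reaches m at [a] and waits there until m; outside this
    unit interval it is the identity, as c >= 1. *)
Lemma cube_map_up m a : m%:~R - 1 < a -> a <= m%:~R ->
  exists2 phi, cube_map phi & phi a = m%:~R.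
Proof.
move=> ma am; pose c := (a - (m%:~R - 1))^-1.
have c1 : 1 <= c by rewrite invf_ge1; lra.
have ac : (a - (m%:~R - 1)) * c = 1 by rewrite divff //; apply/eqP; lra.
exists (fun x => Num.max x
    (Num.min m%:~R (m%:~R - 1 + (x - (m%:~R - 1)) * c))).
  split.
  - apply: cts_max; first exact: cts_id.
    apply: cts_min; first exact: cts_cst.
    apply: ctsD; first exact: cts_cst.
    apply: ctsM; last exact: cts_cst.
    by apply: ctsB; [exact: cts_id|exact: cts_cst].
  - move=> x y xy; rewrite ge_max !le_max xy /= le_min !ge_min lexx /=.
    by apply/orP; right; apply/orP; right; nra.
  - move=> z; apply/max_idPl; rewrite ge_min; apply/orP.
    have [zm|mz] := leP m z; first by left; rewrite ler_int.
    right; have : z%:~R <= m%:~R - 1 :> R by rewrite -(intrB _ m 1) ler_int; lia.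
    nra.
by rewrite ac subrK minxx (max_idPr am).
Qed.

(** Conjugation of [cube_map_up] by x -> -x, which carries [m - 1, m] to [-m, 1 - m]. *)
Lemma cube_map_down m a : m%:~R - 1 <= a -> a < m%:~R ->
  exists2 phi, cube_map phi & phi a = m%:~R - 1.
Proof.
move=> ma am.
have [||phi [cphi hphi iphi] phia] := @cube_map_up (1 - m) (- a); rewrite ?intrB; try lra.
exists (fun x => - phi (- x)); last by rewrite phia intrB; lra.
split.
- have cN : continuous (fun x : R => 0 - x).
    by apply: ctsB; [exact: cts_cst|exact: cts_id].
  rewrite (_ : (fun _ => _) = fun x => 0 - phi (0 - x)); last first.
    by apply/funext => x; rewrite !sub0r.
  exact: cts_comp (cts_comp cN cphi) cN.
- by move=> x y xy; rewrite lerN2 hphi // lerN2.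
- by move=> z; rewrite -mulrNz iphi mulrNz opprK.
Qed.

End cube_map.

(** * Connected realizations and propagation along edges *)

Lemma cts_sum (R : realType) (T : topologicalType) (I : Type) (r : seq I)
    (P : pred I) (F : I -> T -> R) :
  (forall i, continuous (F i)) ->
  continuous (fun t => \sum_(i <- r | P i) F i t).
Proof.
move=> cF; elim: r => [|i r IH].
  rewrite (_ : (fun _ => _) = fun=> 0); first exact: cts_cst.
  by apply/funext => t; rewrite big_nil.
case Pi: (P i).
  rewrite (_ : (fun _ => _) = fun t => F i t + \sum_(i <- r | P i) F i t).
    exact: ctsD.
  by apply/funext => t; rewrite big_cons Pi.
rewrite (_ : (fun _ => _) = fun t => \sum_(i <- r | P i) F i t) //.
by apply/funext => t; rewrite big_cons Pi.
Qed.

(* By closure under subsets P is constant on the support of each point, so the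
   total weight of the vertices satisfying P takes only the values 0 and 1. *)
Lemma realization_propagate (R : realType) n (L : set {set 'I_n}) (P : 'I_n -> Prop) :
  (forall s t : {set 'I_n}, L s -> t \subset s -> L t) ->
  connected (realization R L) ->
  (forall a b, L [set a; b]%SET -> P a -> P b) ->
  forall i j, L [set i]%SET -> L [set j]%SET -> P i -> P j.
Proof.
move=> Lsub Lconn LP i j Li Lj Pi.
pose mass (Q : pred 'I_n) (t : 'rV[R]_n) := \sum_(a | Q a) t 0 a.
have cmass Q : continuous (mass Q).
  by apply: cts_sum => a; exact: coord_continuous.
pose p := [pred a | `[< P a >]].
have deltaL k : L [set k]%SET -> realization R L ('e_k).
  move=> Lk; split.
  - by move=> l; rewrite mxE ler0n.
  - rewrite (bigD1 k) //= mxE !eqxx big1 ?addr0 // => l lk.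
    by rewrite mxE (negbTE lk).
  - rewrite (_ : [set _ | _]%SET = [set k]%SET) //; apply/setP => l.
    by rewrite !inE mxE eqxx /=; case: (l == k); rewrite ?oner_eq0 ?eqxx.
pose B := realization R L `&` [set t | 0 < mass p t].
(* [B] is cut out of the realization by an open condition and, equivalently, by a closed one; it is
   thus clopen there. *)
have BE : B = realization R L `&` [set t | mass (predC p) t <= 0].
  apply/seteqP; split=> t [Lt Bt]; split=> //; have [t0 t1 tL] := Lt.
    have [a pa ta] : exists2 a, p a & t 0 a != 0.
      apply: contrapT => no; move: Bt; rewrite /= /mass big1 ?ltxx // => a pa.
      by apply/eqP; apply: contrapT => /negP ta; apply: no; exists a.
    (* If [b] were in the support, it would span a simplex with [a], so that [P] would pass from [a]
       to [b]. *)
    rewrite /= /mass big1 // => b /= pb; apply/eqP; apply: contraNT pb => tb.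
    apply/asboolP; apply: (LP a) => //; last exact/asboolP.
    apply: Lsub tL _; apply/fintype.subsetP => c.
    by rewrite !inE => /orP[] /eqP ->.
  move: t1; rewrite (bigID p) /= => t1; move: Bt; rewrite /= /mass => Bt.
  lra.
have BL : B = realization R L.
  apply: Lconn.
  - exists 'e_i; split; first exact: deltaL.
    rewrite /= /mass (bigD1 i) /=; last exact/asboolP.
    rewrite mxE !eqxx big1 ?addr0 ?ltr01 // => l /andP[_ li].
    by rewrite mxE (negbTE li).
  - exists [set t | 0 < mass p t] => //.
    by apply: (@open_comp _ _ (mass p) [set x | 0 < x]) => [t _|];
      [exact: cmass|exact: open_gt].
  - exists [set t | mass (predC p) t <= 0] => //.
    by apply: (@closed_comp _ _ (mass (predC p)) [set x | x <= 0]) => [t _|];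
      [exact: cmass|exact: closed_le].
have : B 'e_j by rewrite BL; exact: deltaL.
case=> _ /=; apply: contraPP => Pj; rewrite /mass big1 ?ltxx // => a /asboolP Pa.
by rewrite mxE eqxx /=; case: eqP => // aj; move: Pj; rewrite -aj.
Qed.

(** * Dipaths in a cubical complex with minimal vertex 0 *)

Section cubical_complex.
Variables (R : realType) (n : nat) (K : set 'rV[R]_n).
Hypothesis K_cubical : cubical_complex K.
Hypothesis K_min0 : minimal_vertex K 0.
Implicit Types (k v : 'rV[int]_n) (f g : R -> 'rV[R]_n) (a b i j : 'I_n).

Local Notation "''d_' i" := (indicator [set i]%SET)
  (at level 8, i at level 2, format "''d_' i").

(** The bottom vertex of the box lies in [K], so minimality of 0 places the whole box above 0. *)
Lemma past_linkE k S :
  past_link K 0 k S <-> box (toR R (k - indicator S)) (toR R k) `<=` K.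
Proof.
split=> [kS x /kS[]//|kS x kx]; split; first exact: kS.
have Kv : vertices K (k - indicator S).
  apply: kS; split=> j; rewrite !mxE ?intrB; first exact: lexx.
  by rewrite lerBlDr lerDl ler0z; case: (_ \in _).
split=> j; last by case: kx => _ /(_ j).
case: kx => /(_ j) + _; apply: le_trans.
by have := K_min0.2 _ Kv j; rewrite !mxE -(ler_int R).
Qed.

Lemma dicurve_ge0 k f : dicurve K k f -> forall j, 0 <= k 0 j.
Proof.
move=> df j; have := dicurve_homo df ler01 j.
by rewrite (dicurve_le0 df (lexx 0)) (dicurve_ge1 df (lexx 1)) !mxE ler0z.
Qed.

(** Shortly before the end some coordinate [i] is still below its final value. Cube maps lower it to
    k_i - 1 and raise the others to their final values, so that the deformed curve meets k - e_i. *)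
Lemma dicurve_factor k f : k != 0 -> dicurve K k f ->
  exists i, past_link K 0 k [set i]%SET /\
    exists2 g, dicurve K (k - 'd_i) g & diequiv K k f (extend i g).
Proof.
move=> k0 df.
pose S t := \sum_j f t 0 j.
have cS : continuous S.
  by apply: cts_sum => j; exact: continuous_coord (dicurve_cts df).
have S0 : S 0 = 0.
  by rewrite /S big1 // => j _; rewrite (dicurve_le0 df (lexx 0)) mxE.
have S1E : S 1 = (\sum_j k 0 j)%:~R.
  rewrite /S (dicurve_ge1 df (lexx 1)) rmorph_sum.
  by apply: eq_bigr => j _; rewrite mxE.
have S1 : 1 <= S 1.
  rewrite S1E (ler_int R 1); have kge0 := dicurve_ge0 df.
  rewrite -gtz0_ge1 lt_neqAle sumr_ge0 // andbT eq_sym.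
  apply: contraNneq k0 => /eqP; rewrite psumr_eq0 // => /allP k0.
  apply/eqP/rowP => j; rewrite mxE; apply/eqP.
  by apply: (k0 j); rewrite mem_index_enum.
(* At coordinate sum S 1 - 1/2 each coordinate is within 1/2 of its final value,
   and not all of them have reached it. *)
have [t0 t01 St0] : exists2 t, t \in `[0, 1] & S t = S 1 - 2^-1.
  apply: IVT; first exact: ler01.
    exact: continuous_subspaceT.
  by rewrite S0 ge_min le_max; apply/andP; split; apply/orP; [left|right]; lra.
have {t01} t01 : t0 <= 1 by move: t01; rewrite in_itv => /andP[].
have fk j : f t0 0 j <= (k 0 j)%:~R.
  by have := dicurve_homo df t01 j; rewrite (dicurve_ge1 df (lexx 1)) mxE.
have sum_gap : \sum_j ((k 0 j)%:~R - f t0 0 j) = 2^-1 :> R.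
  rewrite (_ : \sum_j _ = S 1 - S t0); first by rewrite St0; lra.
  by rewrite S1E rmorph_sum -sumrB.
have gap j : (k 0 j)%:~R - 1 < f t0 0 j.
  have : (k 0 j)%:~R - f t0 0 j <= 2^-1 :> R.
    by rewrite -sum_gap (bigD1 j) //= lerDl sumr_ge0 // => l _; rewrite subr_ge0.
  lra.
have [i fi] : exists i, f t0 0 i < (k 0 i)%:~R.
  apply: contrapT => no; have := sum_gap; rewrite big1; first lra.
  move=> j _; apply/eqP; rewrite subr_eq0 eq_le fk andbT leNgt.
  by apply/negP => fj; apply: no; exists j.
have [C [Celem KE]] := K_cubical.
(* A cube of [K] through [f t0] contains the edge: its corners are integral, k_j - 1 < f_j <= k_j
   for all j, and f_i < k_i. *)
have link_i : past_link K 0 k [set i]%SET.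
  apply/past_linkE => x kx; have := dicurve_in df t0.
  rewrite {1}KE => -[[p q] /= Cpq [px qx]]; rewrite KE; exists (p, q) => //=.
  have [lx ux] := kx; split=> j.
    apply: le_trans (lx j); rewrite toR_subE; have := px j; rewrite !mxE => pf.
    have [ji|_] := eqVneq j i; last by rewrite subr0 (le_trans pf).
    rewrite -(intrB _ _ 1) ler_int lerBrDr lezD1 -(ltr_int R).
    by apply: le_lt_trans pf _; rewrite ji.
  apply: le_trans (ux j) _; have := qx j; rewrite !mxE => fq.
  rewrite ler_int -ltzD1 -ltrBlDr -(ltr_int R) intrB.
  exact: lt_le_trans (gap j) fq.
have edge_i : box (toR R (k - 'd_i)) (toR R k) `<=` K by apply/past_linkE.
have /choice[phi phiP] : forall j, exists phi, cube_map phi /\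
    phi (f t0 0 j) = toR R (k - 'd_i) 0 j.
  move=> j; rewrite toR_subE mxE; have [ji|_] := eqVneq j i.
    have [||phi ? ?] := @cube_map_down _ (k 0 j) (f t0 0 j).
    - exact/ltW.
    - by rewrite ji.
    by exists phi.
  have [||phi ? ?] := @cube_map_up _ (k 0 j) (f t0 0 j) => //.
  by exists phi; rewrite subr0.
pose h t : 'rV[R]_n := \row_j phi j (f t 0 j).
have h_box p q t : box (toR R p) (toR R q) (f t) -> box (toR R p) (toR R q) (h t).
  move=> [pf fq]; split=> j; have [[_ hphi iphi] _] := phiP j.
    by have := hphi _ _ (pf j); rewrite !mxE iphi.
  by have := hphi _ _ (fq j); rewrite !mxE iphi.
have h_fix v t : f t = toR R v -> h t = toR R v.
  move=> ft; apply/rowP => j; have [[_ _ iphi] _] := phiP j.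
  by rewrite mxE ft !mxE iphi.
have dh : dicurve K k h.
  split.
  - apply: rV_continuous => j; have [[cphi _ _] _] := phiP j.
    rewrite (_ : (fun _ => _) = fun t => phi j (f t 0 j)); last first.
      by apply/funext => t; rewrite mxE.
    by apply: cts_comp cphi; exact: continuous_coord (dicurve_cts df).
  - move=> s t st j; have [[_ hphi _] _] := phiP j.
    by rewrite !mxE hphi // (dicurve_homo df).
  - move=> t; have := dicurve_in df t; rewrite KE => -[pq Cpq /h_box ht].
    by exists pq.
  - move=> t t_le0; rewrite (h_fix 0); first by apply/rowP => j; rewrite !mxE.
    by rewrite (dicurve_le0 df t_le0); apply/rowP => j; rewrite !mxE.
  - by move=> t t_ge1; apply: h_fix; exact: dicurve_ge1 df _ t_ge1.
have [g dg hg] : exists2 g, dicurve K (k - 'd_i) g & diequiv K k h (extend i g).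
  apply: (diequiv_via_vertex edge_i dh t01).
  by apply/rowP => j; rewrite mxE (phiP j).2.
exists i; split=> //; exists g => //; apply: rst_trans hg; apply: rst_step.
(* [h] maps cubes into themselves, so [f t] and [h t] share a cube of [K]. *)
apply: dihomotopic_line => // t.
have := dicurve_in df t; rewrite {1}KE => -[pq Cpq ft].
exists (toR R pq.1), (toR R pq.2); split=> //; last exact: h_box.
by move=> x pqx; rewrite KE; exists pq.
Qed.

Lemma indicator2 a b : a != b -> indicator [set a; b]%SET = 'd_a + 'd_b :> 'rV[int]_n.
Proof.
move=> ab; apply/rowP => j; rewrite !mxE !inE.
by have [->|ja] := eqVneq j a; rewrite ?(negbTE ab) ?addr0 //= add0r.
Qed.

(** Up to time 1/4 both curves equal g(4t), which gives a one-point box; from then on both lie in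
    the box below k, where the line homotopy applies. *)
Lemma dihomotopic_swap k a b g :
  box (toR R (k - 'd_a - 'd_b)) (toR R k) `<=` K ->
  dicurve K (k - 'd_a - 'd_b) g ->
  dicurve K k (extend a (extend b g)) -> dicurve K k (extend b (extend a g)) ->
  dihomotopic K k (extend a (extend b g)) (extend b (extend a g)).
Proof.
move=> abK dg dab dba; apply: dihomotopic_line => // t.
have [t1|t1] := leP (2 * (2 * t)) 1.
  have gE c d : extend c (extend d g) t = g (2 * (2 * t)).
    rewrite /extend !clamp01_le0 ?scale0r ?addr0 //; first lra.
    have [t0|/ltW t0] := leP 0 t; lra.
  exists (g (2 * (2 * t))), (g (2 * (2 * t))); rewrite !gE; split.
  - move=> x [gx xg]; rewrite (_ : x = g (2 * (2 * t))); first exact: dicurve_in dg _.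
    by apply/rowP => j; apply/eqP; rewrite eq_le gx xg.
  - by split=> j; exact: lexx.
  - by split=> j; exact: lexx.
have gE : g (2 * (2 * t)) = toR R (k - 'd_a - 'd_b) by apply: dicurve_ge1 dg _ (ltW t1).
exists (toR R (k - 'd_a - 'd_b)), (toR R k); split=> //; rewrite /extend gE; split=> j;
  rewrite !shiftE !toR_subE;
  have := clamp01_ge0 (2 * t - 1); have := clamp01_le1 (2 * t - 1);
  have := clamp01_ge0 (2 * (2 * t) - 1); have := clamp01_le1 (2 * (2 * t) - 1);
  case: (j == a); case: (j == b) => /=; lra.
Qed.

(** * Consequences of connected past links *)

Hypothesis links_connected : forall k, vertices K k ->
  connected (realization R (past_link K 0 k)).

(** An edge {a, b} of the link with a != b is a square of [K] with top k; for a = b there is nothing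
    to propagate. *)
Lemma link_propagate k (P : 'I_n -> Prop) : vertices K k ->
  (forall a b, a != b -> box (toR R (k - 'd_a - 'd_b)) (toR R k) `<=` K ->
    P a -> P b) ->
  forall i j, past_link K 0 k [set i]%SET -> past_link K 0 k [set j]%SET ->
    P i -> P j.
Proof.
move=> Kk abP; apply: realization_propagate (links_connected Kk) _.
  by move=> s t; exact: past_link_simplicial.
move=> a b /past_linkE; have [->//|ab] := eqVneq a b.
by rewrite (indicator2 ab) opprD addrA; exact: abP.
Qed.

Lemma sub_box (p q p' q' : 'rV[R]_n) :
  box p q `<=` K -> preceq p p' -> preceq q' q -> box p' q' `<=` K.
Proof.
move=> pqK pp qq x [px xq]; apply: pqK; split=> i.
  exact: le_trans (pp i) (px i).
exact: le_trans (xq i) (qq i).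
Qed.

(** These are the two edges on the route from the bottom of the square through k - e_a to its
    top. *)
Lemma square_edges k a b :
  box (toR R (k - 'd_a - 'd_b)) (toR R k) `<=` K ->
  box (toR R (k - 'd_a)) (toR R k) `<=` K /\
  box (toR R (k - 'd_a - 'd_b)) (toR R (k - 'd_a)) `<=` K.
Proof.
by move=> abK; split; apply: sub_box abK _ _ => j; rewrite ?toR_subE ?lexx //;
  rewrite ?gerBl ?ler0n.
Qed.

Lemma edge_vertex k a : box (toR R (k - 'd_a)) (toR R k) `<=` K ->
  vertices K (k - 'd_a).
Proof.
by apply; split=> j; rewrite ?lexx // toR_subE gerBl ler0n.
Qed.

Lemma sum_sub k a : \sum_j (k - 'd_a) 0 j = \sum_j k 0 j - 1.
Proof.
rewrite (eq_bigr (fun j => k 0 j - 'd_a 0 j)); last by move=> j _; rewrite !mxE.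
rewrite sumrB; congr (_ - _); rewrite (bigD1 a) //= big1 ?addr0.
  by rewrite mxE set11.
by move=> j ja; rewrite mxE inE (negbTE ja).
Qed.

(** The coordinate sum serves as induction measure: it is nonnegative on vertices by minimality of 0
    and drops by 1 along an edge, so a lower neighbour excludes N = 0. *)
Lemma vertex_height k a (N : nat) : vertices K k -> \sum_j k 0 j <= N%:Z ->
  box (toR R (k - 'd_a)) (toR R k) `<=` K ->
  exists2 M, N = M.+1 & \sum_j (k - 'd_a) 0 j <= M%:Z.
Proof.
move=> Kk kN /edge_vertex Ka; move: kN; rewrite sum_sub.
have : 0 <= \sum_j (k - 'd_a) 0 j.
  by apply: sumr_ge0 => j _; have := K_min0.2 _ Ka j; rewrite mxE.
rewrite sum_sub; case: N => [|M]; first by lia.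
by move=> _ kM; exists M => //; lia.
Qed.

(** This is the descent in positive form. Factoring [f] reaches one lower neighbour. Across a
    square, if k - e_b is reachable, induction there reaches k - e_b - e_c, and an edge leads up to
    k - e_c. *)
Lemma lower_reachable (N : nat) k f a : vertices K k -> \sum_j k 0 j <= N%:Z ->
  dicurve K k f -> past_link K 0 k [set a]%SET ->
  exists g, dicurve K (k - 'd_a) g.
Proof.
elim: N k f a => [|N IH] k f a Kk kN df la.
  by have /past_linkE /(vertex_height Kk kN)[] := la.
have k0 : k != 0.
  apply/eqP => k0; have /past_linkE /edge_vertex /K_min0.2 /(_ a) := la.
  by rewrite k0 !mxE set11.
have [i [li [g dg _]]] := dicurve_factor k0 df.
pose P b := exists h, dicurve K (k - 'd_b) h.
apply: (link_propagate (P := P) Kk _ li la); last by exists g.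
move=> {li dg i g} b c bc bcK [h dh].
have [bK cbK] := square_edges bcK.
have [M [MN] hM] := vertex_height Kk kN bK; rewrite -{}MN in hM.
have cl : past_link K 0 (k - 'd_b) [set c]%SET by apply/past_linkE.
have [h' dh'] := IH _ _ _ (edge_vertex bK) hM dh cl.
have cbK' : box (toR R (k - 'd_c - 'd_b)) (toR R k) `<=` K by rewrite addrAC.
exists (extend b h'); apply: dicurve_extend (square_edges cbK').2 _.
by rewrite addrAC.
Qed.

Lemma dicurve_zero f : dicurve K 0 f -> f = fun=> 0.
Proof.
move=> df; apply/funext => t; apply/rowP => j.
have toR0 : toR R 0 = 0 :> 'rV[R]_n by apply/rowP => l; rewrite !mxE.
have [t0|/ltW t0] := leP t 0; first by rewrite (dicurve_le0 df t0).
have [t1|/ltW t1] := leP 1 t; first by rewrite (dicurve_ge1 df t1) toR0.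
have := dicurve_homo df t1 j; have := dicurve_homo df t0 j.
rewrite (dicurve_le0 df (lexx 0)) (dicurve_ge1 df (lexx 1)) toR0 => ft_ge0 ft_le0.
by apply/eqP; rewrite eq_le ft_ge0 ft_le0.
Qed.

Lemma dicurve_diequiv (N : nat) k f g : vertices K k -> \sum_j k 0 j <= N%:Z ->
  dicurve K k f -> dicurve K k g -> diequiv K k f g.
Proof.
elim: N k f g => [|N IH] k f g Kk kN df dg; have [k0|k0] := eqVneq k 0.
(* Goals 1 and 3 are the case k = 0, with only the constant curve; in the other goal with N = 0 a
   lower neighbour is a contradiction. *)
1,3: rewrite k0 in df dg *; rewrite (dicurve_zero df) (dicurve_zero dg);
  exact: rst_refl.
  have [i [/past_linkE li _]] := dicurve_factor k0 df.
  by have [] := vertex_height Kk kN li.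
have [i [li [f1 df1 ff1]]] := dicurve_factor k0 df.
have [j [lj [g1 dg1 gg1]]] := dicurve_factor k0 dg.
have IHe a h h' : box (toR R (k - 'd_a)) (toR R k) `<=` K ->
    dicurve K (k - 'd_a) h -> dicurve K (k - 'd_a) h' ->
    diequiv K k (extend a h) (extend a h').
  move=> aK dh dh'; have [M [MN] hM] := vertex_height Kk kN aK.
  apply: diequiv_extend => //.
  by apply: IH => //; [exact: edge_vertex | rewrite MN].
(* By [IHe], one dipath through k - e_a being equivalent to [f] means that all of the form
   [extend a h] are. *)
pose P a := exists2 h, dicurve K (k - 'd_a) h & diequiv K k f (extend a h).
have [h dh fh] : P j.
  apply: (link_propagate (P := P) Kk _ li lj); last by exists f1.
  move=> a b ab abK [h dh fh].
  have baK : box (toR R (k - 'd_b - 'd_a)) (toR R k) `<=` K by rewrite addrAC.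
  have [aK abK'] := square_edges abK; have [bK baK'] := square_edges baK.
  have [M [MN] hM] := vertex_height Kk kN aK.
  have bl : past_link K 0 (k - 'd_a) [set b]%SET by apply/past_linkE.
  (* [u] runs to the bottom of the square, which is reachable because [h] reaches k - e_a. *)
  have [u du] := lower_reachable (edge_vertex aK) hM dh bl.
  have dbu := dicurve_extend abK' du.
  have dau : dicurve K (k - 'd_b) (extend a u).
    by apply: dicurve_extend => //; rewrite addrAC.
  exists (extend a u) => //.
  (* The chain is [f], [extend a h], [extend a (extend b u)], [extend b (extend a u)]: induction at
     k - e_a, then the swap across the square. *)
  apply: rst_trans fh _; apply: rst_trans (IHe _ _ _ aK dh dbu) _.
  apply: rst_step; apply: dihomotopic_swap => //; exact: dicurve_extend.
apply: rst_trans fh _; apply: rst_trans (rst_sym _ _ _ _ gg1).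
by apply: IHe => //; apply/past_linkE.
Qed.

End cubical_complex.

Theorem theorem2 (R : realType) (n : nat) (K : set 'rV[R]_n)
    (K_cubical : cubical_complex K)
    (K_min0 : minimal_vertex K 0)
    (links_connected : forall k : 'rV[int]_n, vertices K k ->
       connected (realization R (past_link K 0 k))) :
  forall (k : 'rV[int]_n) (Kk : vertices K k),
    connected (dipaths K (vertex_point (proj1 K_min0)) (vertex_point Kk)).
Proof.
move=> k Kk; apply: diequiv_connected => f g.
(* By [lez_abs], the absolute value of the coordinate sum of [k] serves as the bound [N]. *)
exact: (dicurve_diequiv K_cubical K_min0 links_connected Kk (lez_abs _)).
Qed.
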